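(* Let $m\in\mathbb{N}$, let $G_1,\dots,G_m$ be compact Hausdorff topological groups, let $H_i$ be a closed translation invariant subspace of $C(G_i)$ for $i\in\{1,\dots,m\}$, let $F$ be a Banach space, let $\Phi:[0,\infty)\to[0,\infty)$ be a normalized Orlicz function, and let $u:H_1\times\dots\times H_m\to F$ be a translation $m$-invariant $\Phi$-summing operator. Then the normalized Haar measure $\sigma_G$ on $G=G_1\times\dots\times G_m$ is a Pietsch measure for $u$; that is, there is a constant $C>0$ such that for all $(T_1,\dots,T_m)\in H_1\times\dots\times H_m$, $$\|u(T_1,\dots,T_m)\|_F\le C\,\|\odot(T_1,\dots,T_m)\|_{L_\Phi(\sigma_G)},$$ where $\odot(T_1,\dots,T_m)$ is the continuous function on $G$ given by $\odot(T_1,\dots,T_m)(\varphi_1,\dots,\varphi_m)=T_1(\varphi_1)\cdots T_m(\varphi_m)$.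
   Context: All Banach spaces are over the same scalar field $\mathbb{K}=\mathbb{R}$ or $\mathbb{C}$; $C(K)$ is the Banach space of continuous functions $K\to\mathbb{K}$ with the sup norm; $B_{E^*}$ is the closed unit ball of the dual of $E$. The group $G=G_1\times\dots\times G_m$ carries the coordinatewise operation and the product topology. The normalized Haar measure $\sigma_G$ is the unique Radon measure on $G$ with $\sigma_G(G)=1$ and $\sigma_G(\psi B)=\sigma_G(B)$ for every $\psi\in G$ and every Borel set $B\subseteq G$. For $\psi_i\in G_i$, $I_{\psi_i}:G_i\to G_i$ is $I_{\psi_i}(\varphi_i)=\psi_i\varphi_i$. A nonempty subset $H_i\subseteq C(G_i)$ is translation invariant if $T\circ I_{\psi_i}\in H_i$ for all $T\in H_i$, $\psi_i\in G_i$. A map $u$ on $H_1\times\dots\times H_m$ is translation $m$-invariant if $u(T_1\circ I_{\psi_1},\dots,T_m\circ I_{\psi_m})=u(T_1,\dots,T_m)$ for all $(T_1,\dots,T_m)\in H_1\times\dots\times H_m$ and all $(\psi_1,\dots,\psi_m)\in G_1\times\dots\times G_m$. An Orlicz function is a convex, increasing, continuous function $\Phi:[0,\infty)\to[0,\infty)$ with $\Phi(0)=0$; it is normalized if $\Phi(1)=1$. For a $\sigma$-finite measure space $(\Omega,\Sigma,\mu)$, $L_\Phi(\mu)$ is the space of (classes of) measurable scalar functions $f$ on $\Omega$ with $\int_\Omega\Phi(\lambda|f|)\,d\mu<\infty$ for some $\lambda>0$, with the Luxemburg norm $\|f\|_{L_\Phi(\mu)}=\inf\{\varepsilon>0:\int_\Omega\Phi(|f(x)|/\varepsilon)\,d\mu(x)\le1\}$.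 For $n\in\mathbb{N}$ and a positive sequence $\nu=(\nu_j)_{j=1}^n$ in the unit sphere $S_{\ell_1^n}$ (i.e. $\nu_j>0$ and $\sum_j\nu_j=1$), set $\|(x_j)_{j=1}^n\|_{\ell_\Phi^n(\nu)}=\inf\{\varepsilon>0:\sum_{j=1}^n\Phi(|x_j|/\varepsilon)\nu_j\le1\}$. For Banach spaces $E_1,\dots,E_m,F$, a continuous $m$-linear operator $u:E_1\times\dots\times E_m\to F$ is $\Phi$-summing if there is $C>0$ such that for all $n\in\mathbb{N}$, all positive $\nu=(\nu_j)_{j=1}^n\in S_{\ell_1^n}$ and all $(x_{1,j},\dots,x_{m,j})\in E_1\times\dots\times E_m$, $j\in\{1,\dots,n\}$, $$\big\|(\|u(x_{1,j},\dots,x_{m,j})\|_F)_{j=1}^n\big\|_{\ell_\Phi^n(\nu)}\le C\sup_{(\alpha_1,\dots,\alpha_m)\in B_{E_1^*}\times\dots\times B_{E_m^*}}\big\|(\alpha_1(x_{1,j})\cdots\alpha_m(x_{m,j}))_{j=1}^n\big\|_{\ell_\Phi^n(\nu)}.$$ A regular Borel probability measure $\nu$ on $G$ is called a Pietsch measure for such a $u$ if, for some $C>0$, $\|u(T_1,\dots,T_m)\|_F\le C\|\odot(T_1,\dots,T_m)\|_{L_\Phi(\nu)}$ for all $(T_1,\dots,T_m)\in H_1\times\dots\times H_m$. *)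

(* Defs.v *)
From HB Require Import structures.
From mathcomp Require Import all_boot all_order all_algebra.
From mathcomp Require Import all_classical all_reals all_analysis.
From mathcomp Require Import complex.

Set Implicit Arguments.
Unset Strict Implicit.
Unset Printing Implicit Defensive.

Import Order.TTheory GRing.Theory Num.Theory.
Import numFieldNormedType.Exports.

Local Open Scope classical_set_scope.
Local Open Scope ring_scope.

Inductive scalar_kind := RealScalars | ComplexScalars.

Definition scalar_field (R : realType) (k : scalar_kind) : numFieldType :=
  match k with RealScalars => R | ComplexScalars => R[i] end.

Definition scalar_re (R : realType) (k : scalar_kind) : scalar_field R k -> R :=
  match k with RealScalars => id | ComplexScalars => @complex.Re R end.

Definition scalar_of (R : realType) (k : scalar_kind) : R -> scalar_field R k :=
  match k with RealScalars => id | ComplexScalars => fun x => x%:C%C end.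

(* In the library the norm of a normed module over K takes values in K; it is
   real, and normR is the same number seen in R. *)
Definition normR (R : realType) (k : scalar_kind)
  (V : normedModType (scalar_field R k)) (x : V) : R := scalar_re `|x|.

Section scalar_theory.
Context {R : realType} {k : scalar_kind}.
Local Notation K := (scalar_field R k).

Lemma scalar_ofK : cancel (@scalar_of R k) (@scalar_re R k).
Proof. by case: k. Qed.

Lemma scalar_ofD : {morph @scalar_of R k : x y / x + y}.
Proof. by case: k => //= x y; rewrite rmorphD. Qed.

Lemma scalar_ofM : {morph @scalar_of R k : x y / x * y}.
Proof. by case: k => //= x y; rewrite rmorphM. Qed.

Lemma scalar_of0 : @scalar_of R k 0 = 0.
Proof. by case: k. Qed.

Lemma scalar_of_le (x y : R) : (@scalar_of R k x <= scalar_of k y) = (x <= y).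
Proof. by case: k => //=; rewrite lecR. Qed.

Lemma scalar_reK (x : K) : 0 <= x -> scalar_of k (scalar_re x) = x.
Proof.
case: k x => //= -[a b]; rewrite lecE /= => /andP[/eqP b0 _].
by rewrite b0.
Qed.

Lemma scalar_re_le (x y : K) : x <= y -> scalar_re x <= scalar_re y.
Proof. by case: k x y => //= -[a b] [c d]; rewrite lecE => /andP[]. Qed.

Lemma normRE (V : normedModType K) (x : V) : scalar_of k (normR x) = `|x|.
Proof. by rewrite scalar_reK. Qed.

Lemma normR_ge0 (V : normedModType K) (x : V) : 0 <= normR x.
Proof. by rewrite -scalar_of_le normRE scalar_of0. Qed.

Lemma normR0_eq0 (V : normedModType K) (x : V) : normR x = 0 -> x = 0.
Proof.
by move=> x0; apply/eqP; rewrite -normr_eq0 -normRE x0 scalar_of0.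
Qed.

Lemma ler_normRD (V : normedModType K) (x y : V) :
  normR (x + y) <= normR x + normR y.
Proof. by rewrite -scalar_of_le scalar_ofD !normRE ler_normD. Qed.

Lemma normRZ (V : normedModType K) (a : K) (x : V) :
  normR (a *: x) = normR a * normR x.
Proof.
by apply: (can_inj scalar_ofK); rewrite scalar_ofM !normRE normrZ.
Qed.

Lemma scalar_of_lt (x y : R) : (@scalar_of R k x < scalar_of k y) = (x < y).
Proof. by case: k => //=; rewrite ltcR. Qed.

Lemma normR_continuous (V : normedModType K) :
  continuous (@normR R k V : V -> R).
Proof.
have tri (a b : V) : normR a - normR b <= normR (a - b).
  by rewrite lerBlDr -{1}(subrK b a) ler_normRD.
have sym (a b : V) : normR (a - b) = normR (b - a).
  by apply: (can_inj scalar_ofK); rewrite !normRE distrC.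
move=> x; apply/cvgrPdist_lt => e e0.
have ke0 : 0 < scalar_of k e by rewrite -scalar_of0 scalar_of_lt.
near=> y; apply: (@le_lt_trans _ _ (normR (x - y))).
  by rewrite ler_norml tri andbT lerNl opprB sym tri.
rewrite -scalar_of_lt normRE; near: y.
by move: (scalar_of k e) ke0; apply/cvgrPdist_lt; exact: cvg_id.
Unshelve. all: by end_near. Qed.

End scalar_theory.

(* C(X), the space of continuous K-valued functions on the compact space X; the
   proof of compactness is a parameter because the sup norm depends on it. *)
Definition Cfun (R : realType) (k : scalar_kind) (X : topologicalType)
    (cX : compact [set: X]) : Type :=
  continuousType X (scalar_field R k).

Section Cfun.
Context {R : realType} {k : scalar_kind} {X : topologicalType}.
Variable cX : compact [set: X].
Local Notation K := (scalar_field R k).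
Local Notation C := (Cfun R k cX).

HB.instance Definition _ := Choice.on C.

Definition Cfun_fun (f : C) : X -> K := f.

Definition mkC (f : X -> K) (cf : continuous f) : C :=
  (mkcts cf : continuousType X K).

Lemma Cfun_continuous (f : C) : continuous (Cfun_fun f).
Proof. exact: cts_fun. Qed.

Lemma CfunP (f g : C) : Cfun_fun f =1 Cfun_fun g -> f = g.
Proof. by move=> fg; apply/(continuousEP (f : continuousType X K)). Qed.

Fact Cfun_add_subproof (f g : C) : continuous (Cfun_fun f \+ Cfun_fun g).
Proof. by move=> x; apply: continuousD; exact: Cfun_continuous. Qed.
Fact Cfun_opp_subproof (f : C) : continuous (\- Cfun_fun f).
Proof. by move=> x; apply: continuousN; exact: Cfun_continuous. Qed.
Fact Cfun_zero_subproof : continuous (fun _ : X => 0 : K).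
Proof. by move=> x; exact: cst_continuous. Qed.
Fact Cfun_scale_subproof (a : K) (f : C) :
  continuous (fun x => a * Cfun_fun f x).
Proof.
move=> x; apply: (@continuousM _ _ (fun=> a) (Cfun_fun f)).
  exact: cst_continuous.
exact: Cfun_continuous.
Qed.

Definition Cfun_add (f g : C) : C := mkC (@Cfun_add_subproof f g).
Definition Cfun_opp (f : C) : C := mkC (@Cfun_opp_subproof f).
Definition Cfun_zero : C := mkC Cfun_zero_subproof.
Definition Cfun_scale (a : K) (f : C) : C := mkC (@Cfun_scale_subproof a f).

Fact Cfun_addA : associative Cfun_add.
Proof. by move=> f g h; apply: CfunP => x; exact: addrA. Qed.
Fact Cfun_addC : commutative Cfun_add.
Proof. by move=> f g; apply: CfunP => x; exact: addrC. Qed.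
Fact Cfun_add0 : left_id Cfun_zero Cfun_add.
Proof. by move=> f; apply: CfunP => x; exact: add0r. Qed.
Fact Cfun_addN : left_inverse Cfun_zero Cfun_opp Cfun_add.
Proof. by move=> f; apply: CfunP => x; exact: addNr. Qed.

HB.instance Definition _ :=
  GRing.isZmodule.Build C Cfun_addA Cfun_addC Cfun_add0 Cfun_addN.

Fact Cfun_scaleA a b (f : C) :
  Cfun_scale a (Cfun_scale b f) = Cfun_scale (a * b) f.
Proof. by apply: CfunP => x; exact: mulrA. Qed.
Fact Cfun_scale1 : left_id 1 Cfun_scale.
Proof. by move=> f; apply: CfunP => x; exact: mul1r. Qed.
Fact Cfun_scaleDr : right_distributive Cfun_scale +%R.
Proof. by move=> a f g; apply: CfunP => x; exact: mulrDr. Qed.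
Fact Cfun_scaleDl (f : C) : {morph Cfun_scale^~ f : a b / a + b}.
Proof. by move=> a b; apply: CfunP => x; exact: mulrDl. Qed.

HB.instance Definition _ := GRing.Zmodule_isLmodule.Build K C
  Cfun_scaleA Cfun_scale1 Cfun_scaleDr Cfun_scaleDl.

Definition supnorm (f : C) : R :=
  sup (range (fun x => normR (Cfun_fun f x : K^o))).

Lemma supnorm_has_ub (f : C) :
  has_ubound (range (fun x => normR (Cfun_fun f x : K^o))).
Proof.
have : compact ((fun x => normR (Cfun_fun f x : K^o)) @` [set: X]).
  apply: continuous_compact => //; apply: continuous_subspaceT => x.
  apply: (@continuous_comp _ _ _ (Cfun_fun f)
    (@normR R k K^o : K^o -> R)); first exact: Cfun_continuous.
  exact: normR_continuous.
move=> /compact_bounded [M [Mr fM]]; exists (M + 1) => y fy.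
by apply: le_trans (ler_norm _) _; apply: (fM _ _ y fy); rewrite ltrDl.
Qed.

Lemma supnorm_ub (f : C) x : normR (Cfun_fun f x : K^o) <= supnorm f.
Proof. by apply: ub_le_sup; [exact: supnorm_has_ub | exists x]. Qed.

Lemma supnorm_empty (f : C) : ~ ([set: X] !=set0) -> supnorm f = 0.
Proof.
move=> X0; rewrite /supnorm; set A := (X in sup X).
by rewrite (_ : A = set0) ?sup0// -subset0 => y [x _ _]; apply: X0; exists x.
Qed.

Lemma supnorm_le (f : C) (M : R) : 0 <= M ->
  (forall x, normR (Cfun_fun f x : K^o) <= M) -> supnorm f <= M.
Proof.
move=> M0 fM; have [[x _]|/supnorm_empty->//] := pselect ([set: X] !=set0).
by apply: ge_sup => [|_ [y _ <-]//]; exists (normR (Cfun_fun f x : K^o)), x.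
Qed.

Lemma supnorm_ge0 (f : C) : 0 <= supnorm f.
Proof.
have [[x _]|/supnorm_empty->//] := pselect ([set: X] !=set0).
exact: le_trans (normR_ge0 _) (supnorm_ub f x).
Qed.

Lemma supnormD (f g : C) : supnorm (f + g) <= supnorm f + supnorm g.
Proof.
apply: supnorm_le => [|x]; first by rewrite addr_ge0 ?supnorm_ge0.
by apply: le_trans (ler_normRD _ _) _; rewrite lerD ?supnorm_ub.
Qed.

Lemma supnormZ_le (a : K) (f : C) :
  supnorm (a *: f) <= normR (a : K^o) * supnorm f.
Proof.
apply: supnorm_le => [|x]; first by rewrite mulr_ge0 ?supnorm_ge0 ?normR_ge0.
apply: (@le_trans _ _ (normR (a : K^o) * normR (Cfun_fun f x : K^o))).
  by rewrite -(@normRZ R k K^o a (Cfun_fun f x)).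
by rewrite ler_wpM2l ?normR_ge0 ?supnorm_ub.
Qed.

Definition Cfun_norm (f : C) : K := scalar_of k (supnorm f).

Fact Cfun_normD (f g : C) : Cfun_norm (f + g) <= Cfun_norm f + Cfun_norm g.
Proof. by rewrite -scalar_ofD scalar_of_le supnormD. Qed.

Fact Cfun_norm0_eq0 (f : C) : Cfun_norm f = 0 -> f = 0.
Proof.
rewrite -scalar_of0 => /(can_inj (@scalar_ofK R k)) f0; apply: CfunP => x.
apply: (@normR0_eq0 R k K^o); apply/eqP.
by rewrite eq_le normR_ge0 andbT -f0 supnorm_ub.
Qed.

Fact Cfun_normZ (a : K) (f : C) : Cfun_norm (a *: f) = `|a| * Cfun_norm f.
Proof.
rewrite -(@normRE R k K^o) -scalar_ofM; congr scalar_of.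
apply/eqP; rewrite eq_le supnormZ_le /=.
have [->|a0] := eqVneq a 0.
  have -> : normR (0 : K^o) = 0.
    by apply: (can_inj (@scalar_ofK R k)); rewrite normRE normr0 scalar_of0.
  by rewrite mul0r supnorm_ge0.
have na : 0 < normR (a : K^o).
  by rewrite lt_neqAle normR_ge0 andbT eq_sym; apply: contra_neq a0 =>
    /(@normR0_eq0 R k K^o).
rewrite -ler_pdivlMl//.
have -> : (normR (a : K^o))^-1 = normR (a^-1 : K^o).
  apply: (mulfI (lt0r_neq0 na)); rewrite divff ?gt_eqF//.
  rewrite -(@normRZ R k K^o) /GRing.scale/= divff//.
  by apply: (can_inj (@scalar_ofK R k)); rewrite normRE normr1; case: (k).
apply: le_trans (supnormZ_le _ _).
by rewrite scalerA mulVf// scale1r.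
Qed.

HB.instance Definition _ := Lmodule_isNormed.Build K C
  Cfun_normD Cfun_normZ Cfun_norm0_eq0.

End Cfun.

Definition subspace_of (K : numFieldType) (V : normedModType K)
    (H : submodClosed V) : Type := {x : V | x \in H}.

Section subspace_of.
Context {K : numFieldType} {V : normedModType K} {H : submodClosed V}.
Local Notation S := (subspace_of H).

HB.instance Definition _ := SubChoice.copy S {x : V | x \in H}.
HB.instance Definition _ := [SubChoice_isSubLmodule of S by <:].

Fact subspace_normD (x y : S) : `|val (x + y)| <= `|val x| + `|val y|.
Proof. exact: ler_normD. Qed.
Fact subspace_normZ (a : K) (x : S) : `|val (a *: x)| = `|a| * `|val x|.
Proof. exact: normrZ. Qed.
Fact subspace_norm0_eq0 (x : S) : `|val x| = 0 -> x = 0.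
Proof. by move=> /normr0_eq0 x0; apply/val_inj. Qed.

HB.instance Definition _ := Lmodule_isNormed.Build K S
  subspace_normD subspace_normZ subspace_norm0_eq0.

End subspace_of.

HB.mixin Record isTopologicalGroup G of Group G & Topological G := {
  mulg_continuous : continuous (fun x : G * G => (x.1 * x.2)%g);
  invg_continuous : continuous (fun x : G => x^-1%g)
}.

#[short(type="topGroupType")]
HB.structure Definition TopGroup :=
  {G of Group G & Topological G & isTopologicalGroup G}.

Definition prod_group (I : Type) (G : I -> topGroupType) : Type :=
  prod_topology G.

Section prod_group.
Context {I : eqType} {G : I -> topGroupType}.
Local Notation P := (prod_group G).

HB.instance Definition _ := Topological.copy P (prod_topology G).

Definition prod_one : P := fun i => 1%g.
Definition prod_mul (x y : P) : P := fun i => (x i * y i)%g.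
Definition prod_inv (x : P) : P := fun i => (x i)^-1%g.

Fact prod_mulA : associative prod_mul.
Proof.
by move=> x y z; apply: functional_extensionality_dep => i; exact: mulgA. Qed.
Fact prod_mul1 : left_id prod_one prod_mul.
Proof. by move=> x; apply: functional_extensionality_dep => i; exact: mul1g. Qed.
Fact prod_1mul : right_id prod_one prod_mul.
Proof. by move=> x; apply: functional_extensionality_dep => i; exact: mulg1. Qed.
Fact prod_mulV : left_inverse prod_one prod_inv prod_mul.
Proof. by move=> x; apply: functional_extensionality_dep => i; exact: mulVg. Qed.
Fact prod_Vmul : right_inverse prod_one prod_inv prod_mul.
Proof. by move=> x; apply: functional_extensionality_dep => i; exact: mulgV. Qed.

HB.instance Definition _ :=
  isGroup.Build P prod_mulA prod_mul1 prod_1mul prod_mulV prod_Vmul.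

Lemma prod_groupM (x y : P) i : (x * y)%g i = (x i * y i)%g.
Proof. by []. Qed.

Lemma prod_group_continuous (X : topologicalType) (f : X -> P) :
  (forall i, continuous (fun x => f x i)) -> continuous f.
Proof.
by move=> cf x; apply/cvg_sup => i; apply: continuous_comp_initial; exact: cf.
Qed.

Lemma prod_group_proj i : continuous (fun x : P => x i).
Proof. exact: (@proj_continuous I G i). Qed.

Fact prod_mul_continuous : continuous (fun x : P * P => (x.1 * x.2)%g).
Proof.
apply: prod_group_continuous => i x.
apply: (@cvg_comp _ _ _ (fun x : P * P => (x.1 i, x.2 i))
  (fun y : G i * G i => (y.1 * y.2)%g) _ (nbhs (x.1 i, x.2 i))).
  apply: cvg_pair.
    apply: (@cvg_comp _ _ _ fst (fun y : P => y i) _ (nbhs x.1)).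
      exact: cvg_fst.
    exact: prod_group_proj.
  apply: (@cvg_comp _ _ _ snd (fun y : P => y i) _ (nbhs x.2)).
    exact: cvg_snd.
  exact: prod_group_proj.
exact: (@mulg_continuous (G i) (x.1 i, x.2 i)).
Qed.

Fact prod_inv_continuous : continuous (fun x : P => x^-1%g).
Proof.
apply: prod_group_continuous => i x.
apply: (@continuous_comp _ _ _ (fun x : P => x i) (fun y : G i => y^-1%g)).
  exact: prod_group_proj.
exact: invg_continuous.
Qed.

HB.instance Definition _ :=
  isTopologicalGroup.Build P prod_mul_continuous prod_inv_continuous.

End prod_group.

(* Measurable types are pointed; a group is pointed by its unit. *)
Definition pointed_group (G : topGroupType) : Type := G.
HB.instance Definition _ (G : topGroupType) := Choice.on (pointed_group G).
HB.instance Definition _ (G : topGroupType) :=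
  isPointed.Build (pointed_group G) (1%g : G).

(* G with its Borel sigma-algebra; on a product of groups this is the one
   generated by the product topology, which may be strictly larger than the
   product of the Borel sigma-algebras. *)
Definition borel (G : topGroupType) :=
  g_sigma_algebraType (@open G : set (set (pointed_group G))).

(* Locally finite, outer regular on Borel sets, inner regular on open sets; for
   finite measures this is also inner regularity on all Borel sets. *)
Definition radon (R : realType) (G : topGroupType)
    (mu : {measure set (borel G) -> \bar R}) : Prop :=
  [/\ forall A : set G, compact A -> (mu A < +oo)%E,
      forall B : set (borel G), measurable B ->
        mu B = ereal_inf [set mu U | U in [set U : set G | open U /\ B `<=` U]]
    & forall U : set G, open U ->
        mu U =
        ereal_sup [set mu A | A in [set A : set G | compact A /\ A `<=` U]]].

Definition normalized_haar (R : realType) (G : topGroupType)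
    (mu : probability (borel G) R) : Prop :=
  radon mu /\
  forall (psi : G) (B : set (borel G)), measurable B ->
    mu [set (psi * b)%g | b in (B : set G)] = mu B.

(* Phi is only constrained on [0, +oo[; increasing is read as nondecreasing. *)
Record orlicz (R : realType) (Phi : R -> R) : Prop := Orlicz {
  orlicz0 : Phi 0 = 0;
  orlicz_ge0 : forall x, 0 <= x -> 0 <= Phi x;
  orlicz_homo : forall x y, 0 <= x -> x <= y -> Phi x <= Phi y;
  orlicz_convex : convex_function [set x : R^o | 0 <= x] Phi;
  orlicz_continuous : {within [set x | 0 <= x], continuous Phi} }.

Definition normalized_orlicz (R : realType) (Phi : R -> R) : Prop :=
  orlicz Phi /\ Phi 1 = 1.

(* Luxemburg norm of |f| in L_Phi(mu); it is +oo when f is not in L_Phi(mu). *)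
Definition lux_norm (R : realType) (Phi : R -> R) d (T : measurableType d)
    (mu : {measure set T -> \bar R}) (f : T -> R) : \bar R :=
  ereal_inf [set e%:E | e in [set e : R | 0 < e /\
    (\int[mu]_x (Phi (`|f x| / e))%:E <= 1)%E]].

(* The norm of l_Phi^n(nu), as an extended real like lux_norm. *)
Definition lux_seq (R : realType) (Phi : R -> R) (n : nat) (nu x : 'I_n -> R) :
    \bar R :=
  ereal_inf [set e%:E | e in [set e : R | 0 < e /\
    \sum_(j < n) Phi (`|x j| / e) * nu j <= 1]].

(* The continuous linear functionals of operator norm at most 1. *)
Definition dual_ball (K : numFieldType) (E : normedModType K) :
    set {linear E -> K^o} :=
  [set alpha | continuous alpha /\ forall x : E, `|x| <= 1 -> `|alpha x| <= 1].

Definition multilinear (K : numFieldType) (m : nat)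
    (E : 'I_m -> normedModType K) (F : normedModType K)
    (u : prod_topology E -> F) : Prop :=
  forall (x : forall i, E i) (i : 'I_m) (a : K) (y z : E i),
    u (eqtype.dfwith x (a *: y + z)) =
    a *: u (eqtype.dfwith x y) + u (eqtype.dfwith x z).

Definition phi_summing (R : realType) (k : scalar_kind) (Phi : R -> R)
    (m : nat) (E : 'I_m -> normedModType (scalar_field R k))
    (F : normedModType (scalar_field R k)) (u : prod_topology E -> F) : Prop :=
  exists2 C : R, 0 < C &
    forall (n : nat) (nu : 'I_n -> R) (x : 'I_n -> prod_topology E),
      (forall j, 0 < nu j) -> \sum_(j < n) nu j = 1 ->
      (lux_seq Phi nu (fun j => normR (u (x j))) <=
       C%:E * ereal_sup
         [set lux_seq Phi nu
                (fun j => normR ((\prod_(i < m) alpha i (x j i))%R :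
                                   (scalar_field R k)^o))
          | alpha in [set alpha : forall i, {linear E i -> (scalar_field R k)^o} |
                       forall i, dual_ball (alpha i)]])%E.

Section translation.
Context {R : realType} {k : scalar_kind}.

Section one_group.
Context {G : topGroupType} {cG : compact [set: G]}.
Local Notation C := (Cfun R k cG).

Fact translate_subproof (T : C) (psi : G) :
  continuous (fun phi : G => Cfun_fun T (psi * phi)%g).
Proof.
move=> phi; apply: (@continuous_comp _ _ _ (fun x : G => (psi * x)%g)
  (Cfun_fun T)); last exact: Cfun_continuous.
apply: (@cvg_comp _ _ _ (fun x : G => (psi, x))
  (fun y : G * G => (y.1 * y.2)%g) _ (nbhs (psi, phi))).
  by apply: cvg_pair; [exact: cvg_cst|exact: cvg_id].
exact: (@mulg_continuous G (psi, phi)).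
Qed.

Definition translate (T : C) (psi : G) : C := mkC cG (@translate_subproof T psi).

Definition translation_invariant (H : {pred C}) : Prop :=
  forall (T : C) (psi : G), T \in H -> translate T psi \in H.

Definition translate_in (H : submodClosed C) (tH : translation_invariant H)
    (T : subspace_of H) (psi : G) : subspace_of H :=
  exist _ (translate (val T) psi) (tH _ psi (valP T)).

End one_group.

Section several_groups.
Context {m : nat} {G : 'I_m -> topGroupType}.
Context {cG : forall i, compact [set: G i]}.
Variable H : forall i, submodClosed (Cfun R k (@cG i)).

Definition translation_m_invariant
    (tH : forall i, translation_invariant (H i)) (F : Type)
    (u : (forall i, subspace_of (H i)) -> F) : Prop :=
  forall (T : forall i, subspace_of (H i)) (psi : prod_group G),
    u (fun i => translate_in (tH i) (T i) (psi i)) = u T.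

Definition odot (T : forall i, subspace_of (H i)) (phi : prod_group G) :
    scalar_field R k :=
  \prod_(i < m) Cfun_fun (val (T i)) (phi i).

Definition pietsch_measure (Phi : R -> R) (F : normedModType (scalar_field R k))
    (u : (forall i, subspace_of (H i)) -> F)
    (nu : probability (borel (prod_group G)) R) : Prop :=
  radon nu /\
  exists2 C : R, 0 < C &
    forall T : forall i, subspace_of (H i),
      ((normR (u T))%:E <=
       C%:E * lux_norm Phi nu
                (fun phi => normR (odot T phi : (scalar_field R k)^o)))%E.

End several_groups.
End translation.

(* Main.v *)
Require Import Defs.
From mathcomp Require Import all_boot all_order all_algebra.
From mathcomp Require Import all_classical all_reals all_analysis.
From mathcomp Require Import measurable_realfun ring lra.

Set Implicit Arguments.
Unset Strict Implicit.
Unset Printing Implicit Defensive.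

Import Order.TTheory GRing.Theory Num.Theory.
Import numFieldNormedType.Exports.

Local Open Scope classical_set_scope.
Local Open Scope ring_scope.

(* Let e > 0 satisfy int Phi(|odot T| / e) d sigma <= 1.  Test the summing
   inequality on finitely many translates x_j of T with equal weights: by
   invariance its left-hand side is ||u(T)||.  On the right, functionals
   alpha_1, ..., alpha_m can be exchanged one at a time for point evaluations
   without decreasing the modular, because Phi has subgradients and
   |alpha_i| <= 1.  The modular is then at most the supremum over phi of
   (1/n) sum_j f(s_j phi), with f = Phi(|odot T| / e).  As in von Neumann's
   construction of the mean, finitely many translates s_j can be chosen so that
   this average is at most 4 everywhere: while its maximum exceeds 4, averaging
   over further translates lowers it by a fixed amount, since by left invariance
   some value is at most 2.  Hence ||u(T)|| <= 4 C e. *)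

(** * Convexity, subgradients and continuity of Orlicz functions *)

Section orlicz_functions.
Context {R : realType} {Phi : R -> R} (hPhi : orlicz Phi).

Lemma orlicz_conv (t x y : R) : 0 <= t <= 1 -> 0 <= x -> 0 <= y ->
  Phi (t * x + (1 - t) * y) <= t * Phi x + (1 - t) * Phi y.
Proof.
move=> /andP[t0 t1] x0 y0.
have := @orlicz_convex _ _ hPhi (Itv01 t0 t1) x y.
by rewrite !in_setE/= !convRE/=; apply.
Qed.

Lemma orlicz_scale (t x : R) : 0 <= t <= 1 -> 0 <= x ->
  Phi (t * x) <= t * Phi x.
Proof.
move=> t01 x0; have := orlicz_conv t01 x0 (lexx 0).
by rewrite (orlicz0 hPhi) !mulr0 !addr0.
Qed.

(* The subgradient at t is the supremum of the slopes of the chords ending at t. *)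
Lemma orlicz_subgradient (t : R) : 0 <= t ->
  exists2 s, 0 <= s & forall x, 0 <= x -> s * (x - t) <= Phi x - Phi t.
Proof.
rewrite le_eqVlt => /predU1P[<-|t0].
  exists 0 => // x x0; rewrite mul0r (orlicz0 hPhi) subr0.
  exact: orlicz_ge0.
pose S := [set (Phi t - Phi y) / (t - y) | y in [set y | 0 <= y < t]].
(* Slopes increase across [t]: putting weight [(x - t) / (x - y)] on [y] writes [t] as a convex
   combination of [y] and [x]. *)
have chord y x : 0 <= y < t -> t < x ->
    (Phi t - Phi y) / (t - y) <= (Phi x - Phi t) / (x - t).
  move=> /andP[y0 yt] tx; rewrite ler_pdivlMr ?subr_gt0//.
  rewrite mulrAC ler_pdivrMr ?subr_gt0//.
  have yx : 0 < x - y by rewrite subr_gt0 (lt_trans yt).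
  have h01 : 0 <= (x - t) / (x - y) <= 1.
    rewrite divr_ge0 ?subr_ge0 ?(ltW tx) ?(ltW (lt_trans yt tx))//=.
    by rewrite ler_pdivrMr// mul1r lerB// ltW.
  have := orlicz_conv h01 y0 (ltW (lt_trans t0 tx)).
  have -> : (x - t) / (x - y) * y + (1 - (x - t) / (x - y)) * x = t.
    by field; rewrite gt_eqF.
  rewrite -(ler_pM2r yx).
  have -> : ((x - t) / (x - y) * Phi y + (1 - (x - t) / (x - y)) * Phi x) *
    (x - y) = (x - t) * Phi y + (t - y) * Phi x by field; rewrite gt_eqF.
  by lra.
have ubS x : t < x -> ubound S ((Phi x - Phi t) / (x - t)).
  by move=> tx _ [y ? <-]; exact: chord.
have hS : has_ubound S.
  by exists ((Phi (t + 1) - Phi t) / (t + 1 - t)); apply: ubS; rewrite ltrDl.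
(* The chord from 0 makes [S] nonempty, and its slope [Phi t / t] makes [sup S] nonnegative. *)
have S0 : S ((Phi t - Phi 0) / (t - 0)) by exists 0 => //=; rewrite lexx.
exists (sup S).
  apply: le_trans (ub_le_sup hS S0).
  by rewrite orlicz0// !subr0 divr_ge0 ?orlicz_ge0// ltW.
move=> x x0; case: (ltgtP x t) => [xt|tx|->]; last by rewrite !subrr mulr0.
  rewrite -lerN2 -mulrN !opprB -ler_pdivrMr ?subr_gt0//.
  by apply: ub_le_sup => //; exists x => //=; rewrite x0.
rewrite -ler_pdivlMr ?subr_gt0//; apply: ge_sup; last exact: ubS.
by eexists; exact: S0.
Qed.

(** Continuity of [Phi] is only relative to the half-line; since [g] stays there, the filter may be
    restricted to it. *)
Lemma orlicz_comp_continuous (X : topologicalType) (g : X -> R) :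
  (forall x, 0 <= g x) -> continuous g -> continuous (Phi \o g).
Proof.
move=> g0 cg x.
have /subspace_continuousP/(_ (g x) (g0 x)) cP := orlicz_continuous hPhi.
apply: (cvg_comp g Phi _ cP); move=> A /= nA.
apply: (@filterS _ (nbhs x) _ _ _ _ (cg x _ nA)) => y /=; apply; exact: g0.
Qed.

End orlicz_functions.

(** * Exchanging factors inside a convex modular *)

Section exchange.
Context {R : realType} {J : finType}.
Implicit Types (S : set (J -> R)).

(** Holds whenever [a] is coordinatewise below a convex combination of points of [S]. This dual form
    is the one that subgradients use; [z] may depend on [w]. *)
Definition dominated S (a : J -> R) :=
  forall w : J -> R, (forall j, 0 <= w j) ->
    exists2 z, S z & \sum_j w j * a j <= \sum_j w j * z j.

(** Linearize [Phi] at each [a j * b j] with slope [s j] and test domination with the weights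
    [nu j * s j * b j]: the linear increments have nonnegative weighted sum, and convexity puts
    those of [Phi] above them. *)
Lemma dominated_orlicz (Phi : R -> R) S (nu b a : J -> R) :
  orlicz Phi -> (forall j, 0 <= nu j) -> (forall j, 0 <= b j) ->
  (forall j, 0 <= a j) -> (forall z, S z -> forall j, 0 <= z j) ->
  dominated S a ->
  exists2 z, S z & \sum_j nu j * Phi (a j * b j) <= \sum_j nu j * Phi (z j * b j).
Proof.
move=> hPhi nu0 b0 a0 S0 aS.
have /choice[s hs] : forall j, exists sj : R, 0 <= sj /\
    forall x, 0 <= x -> sj * (x - a j * b j) <= Phi x - Phi (a j * b j).
  move=> j; have [sj ? ?] := orlicz_subgradient hPhi (mulr_ge0 (a0 j) (b0 j)).
  by exists sj.
have [j|z Sz wz] := aS (fun j => nu j * s j * b j).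
  by rewrite !mulr_ge0//; have [] := hs j.
exists z => //; rewrite -subr_ge0 -sumrB.
move: wz; rewrite -subr_ge0 -sumrB => /le_trans; apply.
apply: ler_sum => j _ /=; rewrite -[leRHS]mulrBr.
have -> : nu j * s j * b j * z j - nu j * s j * b j * a j =
  nu j * (s j * (z j * b j - a j * b j)) by ring.
by rewrite ler_wpM2l//; apply: (hs j).2; rewrite mulr_ge0// S0.
Qed.

Lemma dominated_prod_orlicz (Phi : R -> R) (m : nat) (S : 'I_m -> set (J -> R))
    (nu : J -> R) (c : R) (a : 'I_m -> J -> R) :
  orlicz Phi -> (forall j, 0 <= nu j) -> 0 <= c ->
  (forall i j, 0 <= a i j) -> (forall i z, S i z -> forall j, 0 <= z j) ->
  (forall i, dominated (S i) (a i)) ->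
  exists2 z : 'I_m -> J -> R, (forall i, S i (z i)) &
    \sum_j nu j * Phi ((\prod_i a i j) * c) <=
    \sum_j nu j * Phi ((\prod_i z i j) * c).
Proof.
move=> hPhi nu0 c0 a0 S0 aS.
(* The factors are exchanged in order: those below [n] are done, the others are still [a i]. *)
suff /(_ m (leqnn m))[z [zS _ zle]] : forall n, (n <= m)%N ->
    exists z : 'I_m -> J -> R,
    [/\ forall i : 'I_m, (i < n)%N -> S i (z i),
        forall i : 'I_m, (n <= i)%N -> z i = a i &
        \sum_j nu j * Phi ((\prod_i a i j) * c) <=
        \sum_j nu j * Phi ((\prod_i z i j) * c)].
  by exists z => // i; exact: zS.
elim=> [_|n IH nm]; first by exists a.
have [z [zS za zle]] := IH (ltnW nm).
pose i0 := Ordinal nm.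
have z0 i j : 0 <= z i j.
  by have [/zS/S0|/za->] := ltnP i n.
have zi0 : z i0 = a i0 by exact: za.
pose b j := (\prod_(i | i != i0) z i j) * c.
have b0 j : 0 <= b j by rewrite mulr_ge0// prodr_ge0.
have [y Sy yle] := dominated_orlicz hPhi nu0 b0 (a0 i0) (S0 i0) (aS i0).
exists (fun i => if i == i0 then y else z i); split.
- move=> i; rewrite ltnS leq_eqVlt => /orP[in0|ilt].
    by have /eqP-> : i == i0 by []; rewrite eqxx.
  case: eqP => [->//|_]; exact: zS.
- move=> i ni; case: eqP => [ii0|_]; first by rewrite ii0 /= ltnn in ni.
  by apply: za; exact: ltnW.
- apply: le_trans zle _; move: yle; rewrite -zi0.
  congr (_ <= _); apply: eq_bigr => j _; congr (_ * Phi _).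
    by rewrite /b mulrA [in RHS](bigD1 i0).
  rewrite /b mulrA [in RHS](bigD1 i0)//= eqxx; congr (_ * _ * _).
  by apply: eq_bigr => i /negbTE->.
Qed.

End exchange.

(** * Averages of left translates on a compact group *)

Section averaging.
Context {R : realType} {G : topGroupType}.

Lemma mulgl_continuous (psi : G) : continuous (fun x : G => (psi * x)%g).
Proof.
move=> x; apply: (@cvg_comp _ _ _ (fun x : G => (psi, x))
  (fun y : G * G => (y.1 * y.2)%g) _ (nbhs (psi, x))).
  by apply: cvg_pair; [exact: cvg_cst|exact: cvg_id].
exact: (@mulg_continuous G (psi, x)).
Qed.

Lemma continuous_borel_measurable (f : G -> R) : continuous f ->
  measurable_fun [set: borel G] (f : borel G -> R).
Proof.
move=> /continuousP cf; apply: (measurability _ (RGenOpens.measurableE R)).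
move=> _ [_ [a [b ->] <-]]; rewrite setTI; apply: sub_sigma_algebra.
exact/cf/interval_open.
Qed.

Lemma mulgl_measurable (psi : G) :
  measurable_fun [set: borel G] (fun x : borel G => (psi * (x : G))%g : borel G).
Proof.
apply: (@measurability _ _ (borel G) (borel G) setT _
  (@open G : set (set (borel G))) erefl) => _ [U oU <-].
rewrite setTI; apply: sub_sigma_algebra.
by have /continuousP := @mulgl_continuous psi; apply.
Qed.

Definition left_invariant (mu : set (borel G) -> \bar R) :=
  forall (psi : G) (B : set (borel G)), measurable B ->
    mu [set (psi * b)%g | b in (B : set G)] = mu B.

Context {mu : probability (borel G) R} (mu_inv : left_invariant mu).

(** Pushing [mu] forward along translation by [psi] gives [mu] again, because [psi] times the
    preimage of [A] is [A]. *)
Lemma integral_mulgl (f : G -> R) (psi : G) :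
  (forall x, 0 <= f x) -> continuous f ->
  (\int[mu]_x (f (psi * (x : G))%g)%:E = \int[mu]_x (f x)%:E)%E.
Proof.
move=> f0 cf; have mpsi := mulgl_measurable psi.
have mf : measurable_fun [set: borel G] (fun x : borel G => (f x)%:E).
  by apply/measurable_EFinP; exact: continuous_borel_measurable.
have := ge0_integral_pushforward mpsi mu measurableT mf.
rewrite preimage_setT => <-; last by move=> y _ /=; rewrite lee_fin.
apply: eq_measure_integral => A mA _ /=; rewrite /pushforward -(mu_inv psi); last first.
  by rewrite -[X in measurable X]setTI; exact: mpsi.
congr (mu _); apply/seteqP; split => [_ [b Ab <-]//|x Ax].
by exists (psi^-1 * (x : G))%g => /=; rewrite mulgA mulgV mul1g.
Qed.

(** The difference [f (x * y) - f x] is jointly continuous and vanishes at [y = 1]; compactness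
    makes the neighbourhood of 1 independent of [x]. *)
Lemma mulgr_uniform (cG : compact [set: G]) (f : G -> R) (e : R) : 0 < e ->
  continuous f -> exists2 U, nbhs (1%g : G) U &
    forall x y, U y -> f (x * y)%g <= f x + e.
Proof.
move=> e0 cf; exists [set y | forall x, f (x * y)%g <= f x + e] => //.
suff : \forall y \near (1%g : G), [set: G] `<=` [set x | f (x * y)%g <= f x + e].
  by apply: filterS => y fy x; exact: fy.
apply: ((compact_near_coveringP _).1 cG) => x _.
pose h := fun z : G * G => f (z.1 * z.2)%g - f z.1.
have ch : h z @[z --> (x, 1%g : G)] --> h (x, 1%g).
  apply: cvgB.
    apply: (@cvg_comp _ _ _ (fun z : G * G => (z.1 * z.2)%g) f _
      (nbhs (x * 1)%g)); [exact: (mulg_continuous (x, 1%g))|exact: cf].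
  by apply: (@cvg_comp _ _ _ fst f _ (nbhs x)); [exact: cvg_fst|exact: cf].
rewrite {2}/h /= mulg1 subrr in ch.
have : \forall z \near (x, 1%g : G), h z < e.
  exact: (cvgr_lt _ ch).
by apply: filterS => -[a b] /=; rewrite /h/= => /ltW; rewrite lerBlDl.
Qed.

Lemma finite_translates_cover (cG : compact [set: G]) (U : set G) :
  nbhs (1%g : G) U ->
  exists s : seq G, forall x : G, exists2 y, y \in s & U (y^-1 * x)%g.
Proof.
(* compact_cover needs a pointed space; near coverings along the filter of
   large finite sequences do not. *)
move=> U1.
pose F := [set P : set (seq G) | exists s0 : seq G, forall s, {subset s0 <= s} -> P s].
have FF : Filter F.
  split; first by exists [::].
    move=> P Q [s Ps] [t Qt]; exists (s ++ t) => r str; split.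
      by apply: Ps => x xs; apply: str; rewrite mem_cat xs.
    by apply: Qt => x xs; apply: str; rewrite mem_cat xs orbT.
  by move=> P Q PQ [s Ps]; exists s => t /Ps/PQ.
suff [s0 /(_ s0 (fun=> id)) sP] :
    F [set s : seq G | [set: G] `<=` [set x | exists2 y, y \in s & U (y^-1 * x)%g]].
  by exists s0 => x; apply: sP.
apply: ((compact_near_coveringP _).1 cG _ F
  (fun s x => exists2 y, y \in s & U (y^-1 * x)%g) FF) => x _.
exists ([set x' | U (x^-1 * x')%g], [set s : seq G | x \in s]).
  split=> /=; last by exists [:: x] => s; apply; rewrite inE.
  by apply: (@mulgl_continuous x^-1%g x); rewrite mulVg.
by move=> [x' s] [/= Ux' xs]; exists x.
Qed.

(** Translates may repeat and any finite index type is allowed, so that iterating averages just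
    takes products of index types. *)
Definition average_bounded (f : G -> R) (B : R) := exists (I : finType) (s : I -> G),
  (0 < #|I|)%N /\ forall x, \sum_i f (s i * x)%g <= B * #|I|%:R.

Lemma average_bounded_le f B B' : B <= B' ->
  average_bounded f B -> average_bounded f B'.
Proof.
move=> BB' [I [s [I0 sB]]]; exists I, s; split=> // x.
by apply: le_trans (sB x) _; rewrite ler_wpM2r.
Qed.

(** By left invariance the sum integrates to at most [#|I|], so it cannot exceed [2 * #|I|]
    everywhere. The gap between 1 and 2 avoids a strict comparison of integrals. *)
Lemma average_small_point (f : G -> R) (I : finType) (s : I -> G) :
  (forall x, 0 <= f x) -> continuous f -> (\int[mu]_x (f x)%:E <= 1)%E ->
  (0 < #|I|)%N -> exists x, \sum_i f (s i * x)%g <= 2 * #|I|%:R.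
Proof.
move=> f0 cf f1 I0; apply/not_existsP => big.
have cfs i : continuous (fun x => f (s i * x)%g).
  by move=> x; apply: continuous_comp; [exact: mulgl_continuous|exact: cf].
have mfs i : measurable_fun [set: borel G] (fun x : borel G => (f (s i * x)%g)%:E).
  by apply/measurable_EFinP; exact: continuous_borel_measurable.
have := @ge0_integral_sum _ _ _ mu _ measurableT _ _ mfs
  (fun i x _ => f0 (s i * x)%g) (index_enum I).
rewrite (eq_bigr (fun=> (\int[mu]_x (f x)%:E)%E)); last first.
  by move=> i _; exact: integral_mulgl.
move=> eq_int.
have : ((2 * #|I|%:R)%:E <= \sum_(i : I) (\int[mu]_x (f x)%:E))%E.
  rewrite -eq_int -[leLHS]mule1 -(@probability_setT _ _ _ mu) -integral_cst//.
  apply: ge0_le_integral => //=.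
  - exact: emeasurable_sum.
  - by move=> x _; rewrite sumEFin lee_fin ltW// ltNge; apply/negP; exact: big.
apply/negP; rewrite -ltNge.
apply: (@le_lt_trans _ _ (\sum_(i : I) 1%E)); first exact: lee_sum.
rewrite sumEFin lte_fin sumr_const -[_ *+ _]mulr_natl mulr1.
by rewrite ltr_pMl ?ltr0n// ltr1n.
Qed.

(** Average again over the translations by [x0 * y^-1] for [y] in [t]. Each block is at most
    [B * #|I|], and one of them is at most [3 * #|I|], hence at most [(B - 1) * #|I|]. The gain
    [1 / size t] does not depend on [B], so the step can be iterated. *)
Lemma average_step (cG : compact [set: G]) (f : G -> R) :
  (forall x, 0 <= f x) -> continuous f -> (\int[mu]_x (f x)%:E <= 1)%E ->
  exists2 e, 0 < e &
    forall B, 4 <= B -> average_bounded f B -> average_bounded f (B - e).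
Proof.
move=> f0 cf f1; have [U U1 fU] := mulgr_uniform cG ltr01 cf.
have [t tU] := finite_translates_cover cG U1.
have t0 : (0 < size t)%N by have [y yt _] := tU 1%g; case: (t) yt.
exists (size t)%:R^-1; first by rewrite invr_gt0 ltr0n.
move=> B B4 [I [s [I0 sB]]].
have [x0 x0s] := average_small_point s f0 cf f1 I0.
(* For each x some y in t has x0 y^-1 x in x0 U, where the average is at most 3. *)
exists (I * 'I_(size t))%type,
  (fun p : I * 'I_(size t) => s p.1 * (x0 * (nth 1 t p.2)^-1))%g.
rewrite card_prod card_ord muln_gt0 I0 t0; split=> // x.
rewrite -(pair_bigA _ (fun i j => f (s i * (x0 * (nth 1 t (nat_of_ord j))^-1) * x)%g))/=.
rewrite exchange_big/=.
have [y yt Uy] := tU x.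
have yt' : (index y t < size t)%N by rewrite index_mem.
rewrite (bigD1 (Ordinal yt'))//= nth_index//.
have le3 : \sum_i f (s i * (x0 * y^-1) * x)%g <= 3 * #|I|%:R.
  apply: (@le_trans _ _ (\sum_i (f (s i * x0)%g + 1))).
    by apply: ler_sum => i _; rewrite -!mulgA (mulgA (s i)); exact: fU.
  rewrite big_split/= sumr_const; lra.
have leB : \sum_(j | j != Ordinal yt')
    \sum_i f (s i * (x0 * (nth 1 t (nat_of_ord j))^-1) * x)%g <=
    ((size t)%:R - 1) * (B * #|I|%:R).
  apply: (@le_trans _ _ (\sum_(j < size t | j != Ordinal yt') (B * #|I|%:R))).
    apply: ler_sum => j _; apply: le_trans (sB (x0 * (nth 1%g t j)^-1 * x)%g).
    by apply: ler_sum => i _; rewrite !mulgA.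
  rewrite sumr_const cardC1 card_ord -[in leRHS](prednK t0) -natr1 addrK.
  by rewrite mulr_natl.
apply: le_trans (lerD le3 leB) _.
have -> : (B - (size t)%:R^-1) * (#|I| * size t)%:R =
  B * #|I|%:R * (size t)%:R - #|I|%:R.
  by rewrite natrM; field; rewrite pnatr_eq0 -lt0n.
have : 0 <= (B - 4) * #|I|%:R by rewrite mulr_ge0// subr_ge0.
nra.
Qed.

Lemma average_bounded4 (cG : compact [set: G]) (f : G -> R) :
  (forall x, 0 <= f x) -> continuous f -> (\int[mu]_x (f x)%:E <= 1)%E ->
  exists n (s : 'I_n.+1 -> G), forall x, \sum_i f (s i * x)%g <= 4 * n.+1%:R.
Proof.
move=> f0 cf f1; have [e e0 fe] := average_step cG f0 cf f1.
have [c _ fc] : exists2 c, c \in [set: G] & forall t, t \in [set: G] -> f t <= f c.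
  by apply: compact_EVT_max => //; [exists 1%g|exact: continuous_subspaceT].
(* Since [f c] is the maximum of [f], the single translate by 1 starts the descent; the maximum with
   4 keeps [average_step] applicable. *)
have avg k : average_bounded f (Num.max 4 (f c - k%:R * e)).
  elim: k => [|k IH].
    exists unit, (fun=> 1%g); rewrite card_unit; split=> // x.
    rewrite big_const card_unit /= addr0 mul1g mulr1 mul0r subr0 le_max.
    by rewrite fc ?inE// orbT.
  apply: average_bounded_le (fe _ _ IH); last by rewrite le_max lexx.
  rewrite lerBlDr ge_max -!lerBlDr; apply/andP; split.
    by rewrite le_max lerBlDr lerDl ltW.
  by rewrite le_max -(natr1 k) mulrDl mul1r opprD addrA lexx orbT.
pose k := Num.bound (f c / e).
have fce : f c - k%:R * e <= 4.
  rewrite lerBlDr (@le_trans _ _ (k%:R * e)) ?lerDr// -ler_pdivrMr//.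
  by rewrite ltW// archi_boundP// divr_ge0// ltW.
have [I [s [I0 sB]]] := avg k; rewrite max_l// in sB.
exists #|I|.-1; rewrite prednK//; exists (s \o enum_val) => x.
by rewrite -(big_enum_val (fun i : I => f (s i * x)%g)).
Qed.

End averaging.

(** * Norms of scalars and functionals in the dual ball *)

Section scalar_norm.
Context {R : realType} {k : scalar_kind}.
Local Notation K := (scalar_field R k).
Local Notation nK := (@normR R k K^o).

Lemma normR_scalar_of (x : R) : 0 <= x -> nK (scalar_of k x) = x.
Proof.
move=> x0; apply: (can_inj (@scalar_ofK R k)); rewrite normRE ger0_norm//.
by rewrite -scalar_of0 scalar_of_le.
Qed.

Lemma normRM (a b : K) : nK (a * b) = nK a * nK b.
Proof. exact: (@normRZ R k K^o a b). Qed.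

Lemma normR_prod (I : finType) (a : I -> K) : nK (\prod_i a i) = \prod_i nK (a i).
Proof.
elim/big_ind2 : _ => // [|_ a1 _ a2 <- <-]; last exact: normRM.
by apply: (can_inj (@scalar_ofK R k)); rewrite normRE normr1; case: (k).
Qed.

Lemma normR_sum (V : normedModType K) (I : finType) (a : I -> V) :
  normR (\sum_i a i) <= \sum_i normR (a i).
Proof.
elim/big_ind2 : _ => // [|x1 x2 y1 y2 h1 h2].
  rewrite (_ : normR 0 = 0)//; apply: (can_inj (@scalar_ofK R k)).
  by rewrite normRE normr0 scalar_of0.
by apply: le_trans (ler_normRD _ _) _; exact: lerD.
Qed.

Lemma scalar_of_sum (I : finType) (a : I -> R) :
  scalar_of k (\sum_i a i) = \sum_i scalar_of k (a i).
Proof. by apply: big_morph; [exact: scalar_ofD|exact: scalar_of0]. Qed.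

Lemma dual_ball_normR (E : normedModType K) (alpha : {linear E -> K^o}) (x : E) :
  dual_ball alpha -> normR (alpha x) <= normR x.
Proof.
move=> [_ a1]; rewrite -(@scalar_of_le R k) !normRE.
have [->|x0] := eqVneq x 0; first by rewrite linear0 !normr0.
have nx0 : 0 < `|x| by rewrite normr_gt0.
have := a1 (`|x|^-1 *: x).
rewrite normrZ normfV normr_id mulVf ?gt_eqF// lexx => /(_ isT).
by rewrite linearZ/= normrM normfV normr_id ler_pdivrMl// mulr1.
Qed.

(* Testing against the coefficients w_j sgn(alpha(x_j))^* turns the bound
   |alpha| <= 1 into a bound by the sup norm of one function, attained at some
   point; no representation of alpha by a measure is required. *)
Lemma dual_ball_dominated (G : topGroupType) (cG : compact [set: G])
    (H : submodClosed (Cfun R k cG)) (J : finType) (x : J -> subspace_of H)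
    (alpha : {linear subspace_of H -> K^o}) :
  dual_ball alpha ->
  dominated (range (fun (p : G) j => nK (Cfun_fun (val (x j)) p)))
    (fun j => nK (alpha (x j))).
Proof.
move=> a1 w w0.
(* The factor [|z| / z] turns [z] into its modulus; where [alpha (x j)] is 0 the quotient is 0, so
   [cw] is only an inequality. *)
pose c j : K := scalar_of k (w j) * `|alpha (x j)| / alpha (x j).
have ca j : c j * alpha (x j) = scalar_of k (w j * nK (alpha (x j))).
  rewrite scalar_ofM normRE /c; have [->|ax0] := eqVneq (alpha (x j)) 0.
    by rewrite normr0 !mulr0.
  by rewrite divfK.
have cw j : nK (c j) <= w j.
  rewrite -(@scalar_of_le R k) normRE /c !normrM normfV normr_id -mulrA.
  rewrite -(@normRE R k K^o (scalar_of k (w j))) normR_scalar_of//.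
  have [->|ax0] := eqVneq (alpha (x j)) 0.
    by rewrite normr0 mul0r mulr0 -scalar_of0 scalar_of_le.
  by rewrite divff ?mulr1// normr_eq0.
pose X := \sum_j c j *: x j.
have cX : continuous (fun p => nK (Cfun_fun (val X) p)).
  move=> p; apply: (@continuous_comp _ _ _ (Cfun_fun (val X)) (nK : K^o -> R)).
    exact: Cfun_continuous.
  exact: normR_continuous.
have [p _ pX] : exists2 p, p \in [set: G] & forall t, t \in [set: G] ->
    nK (Cfun_fun (val X) t) <= nK (Cfun_fun (val X) p).
  by apply: compact_EVT_max => //; [exists 1%g|exact: continuous_subspaceT].
exists (fun j => nK (Cfun_fun (val (x j)) p)); first by exists p.
have -> : \sum_j w j * nK (alpha (x j)) = nK (alpha X).
  rewrite /X linear_sum/= -[LHS]normR_scalar_of; last first.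
    by apply: sumr_ge0 => j _; rewrite mulr_ge0// normR_ge0.
  by congr nK; rewrite scalar_of_sum; apply: eq_bigr => j _; rewrite linearZ -ca.
apply: le_trans (dual_ball_normR _ a1) _.
apply: (@le_trans _ _ (nK (Cfun_fun (val X) p))).
  rewrite (_ : normR X = supnorm (val X)); last first.
    exact: scalar_ofK.
  apply: supnorm_le => [|t]; first exact: normR_ge0.
  by apply: pX; rewrite inE.
have -> : Cfun_fun (val X) p = \sum_j c j * Cfun_fun (val (x j)) p.
  rewrite /X; elim/big_ind2 : _ => // y1 y2 z1 z2 <- <-; exact: erefl.
apply: le_trans (normR_sum _) _; apply: ler_sum => j _.
by rewrite normRM ler_wpM2r// normR_ge0.
Qed.

End scalar_norm.

(** * Compactness and continuity on the product group *)

Lemma compact_prod_group (I : eqType) (G : I -> topGroupType) :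
  (forall i, compact [set: G i]) -> compact [set: prod_group G].
Proof.
move=> cG; rewrite (_ : [set: prod_group G] = [set g | forall i, [set: G i] (g i)]).
  exact: (tychonoff cG).
by apply/seteqP; split.
Qed.

Lemma odot_continuous (R : realType) (k : scalar_kind) (m : nat)
    (G : 'I_m -> topGroupType) (cG : forall i, compact [set: G i])
    (H : forall i, submodClosed (Cfun R k (cG i)))
    (T : forall i, subspace_of (H i)) : continuous (odot T).
Proof.
rewrite /odot; elim: (index_enum _) => [|i r cr] phi.
  by under eq_fun do rewrite big_nil; exact: cst_continuous.
under eq_fun do rewrite big_cons.
apply: (@continuousM _ _ (fun phi : prod_group G => Cfun_fun (val (T i)) (phi i))).
  apply: (@continuous_comp _ _ _ (fun phi : prod_group G => phi i)
    (Cfun_fun (val (T i)))); first exact: prod_group_proj.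
  exact: Cfun_continuous.
exact: cr.
Qed.

(** * Luxemburg norms of finite sequences *)

Section luxemburg.
Context {R : realType} {Phi : R -> R} (hPhi : normalized_orlicz Phi).
Context {n : nat} {nu : 'I_n -> R} (nu1 : \sum_j nu j = 1).

(** If [0 < e < c], convexity and [Phi 1 = 1] give [1 <= e / c * Phi (c / e)], hence
    [Phi (c / e) > 1] and [e] is not admissible. *)
Lemma lux_seq_cst_ge (c : R) : (c%:E <= lux_seq Phi nu (fun=> c))%E.
Proof.
apply: le_ereal_inf_tmp => _ [e [e0 +] <-]; rewrite -mulr_sumr nu1 mulr1 lee_fin.
apply: contraTT; rewrite -!ltNge => ec.
have c0 : 0 < c by exact: lt_trans ec.
have : Phi (e / c * (c / e)) <= e / c * Phi (c / e).
  apply: (orlicz_scale hPhi.1); last by rewrite divr_ge0 ?ltW.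
  by rewrite ler_pdivrMr// mul1r (ltW ec) divr_ge0// ltW.
have -> : e / c * (c / e) = 1 by field; rewrite !gt_eqF.
rewrite hPhi.2 mulrAC ler_pdivlMr// mul1r gtr0_norm// => ce.
have : e * 1 < e * Phi (c / e) by rewrite mulr1 (lt_le_trans ec).
by rewrite ltr_pM2l.
Qed.

(** Dividing the argument by [M >= 1] divides [Phi] by at least [M], so a modular bound [M] at [e]
    makes [M * e] admissible. *)
Lemma lux_seq_le (x : 'I_n -> R) (e M : R) : 0 < e -> 1 <= M ->
  (forall j, 0 <= nu j) -> \sum_j nu j * Phi (`|x j| / e) <= M ->
  (lux_seq Phi nu x <= (M * e)%:E)%E.
Proof.
move=> e0 M1 nu0 hM; have M0 : 0 < M by exact: lt_le_trans M1.
apply: ge_ereal_inf; exists (M * e)%:E => //; exists (M * e) => //=.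
rewrite mulr_gt0//; split=> //.
apply: (@le_trans _ _ (\sum_j M^-1 * (nu j * Phi (`|x j| / e)))).
  apply: ler_sum => j _.
  have -> : `|x j| / (M * e) = M^-1 * (`|x j| / e) by field; rewrite !gt_eqF.
  rewrite [leRHS]mulrCA [leLHS]mulrC ler_wpM2l//; apply: (orlicz_scale hPhi.1).
    by rewrite invf_le1// M1 invr_ge0 ltW.
  by rewrite divr_ge0// ltW.
by rewrite -mulr_sumr ler_pdivrMl// mulr1.
Qed.

End luxemburg.

Theorem theorem5p4 (R : realType) (k : scalar_kind) (m : nat) (m_gt0 : (0 < m)%N)
    (G : 'I_m -> topGroupType)
    (cG : forall i, compact [set: G i])
    (hG : forall i, hausdorff_space (G i))
    (H : forall i, submodClosed (Cfun R k (cG i)))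
    (closedH : forall i, closed [set T : Cfun R k (cG i) | T \in H i])
    (tH : forall i, translation_invariant (H i))
    (F : completeNormedModType (scalar_field R k))
    (Phi : R -> R) (hPhi : normalized_orlicz Phi)
    (u : prod_topology (fun i => subspace_of (H i) : normedModType (scalar_field R k)) -> F)
    (u_linear : multilinear u) (u_continuous : continuous u)
    (u_summing : phi_summing Phi u)
    (u_invariant : translation_m_invariant tH u)
    (sigma : probability (borel (prod_group G)) R)
    (sigma_haar : normalized_haar sigma) :
  pietsch_measure Phi u sigma.
Proof.
have [C C0 uC] := u_summing; split; first exact: sigma_haar.1.
(* [C] comes from summability, 4 from the averaging bound. Moving the product into the infimum
   leaves one inequality for each admissible [e]. *)
exists (C * 4) => [|T]; first by rewrite mulr_gt0.
rewrite -ereal_inf_pZl ?mulr_gt0//.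
apply: le_ereal_inf_tmp => _ [_ [e [e0 int1] <-] <-].
pose h phi := normR (odot T phi : (scalar_field R k)^o).
have h0 phi : 0 <= `|h phi| / e by rewrite divr_ge0// ltW.
have ch : continuous (fun phi => `|h phi| / e).
  move=> phi; apply: (@continuousM _ _ (fun phi => `|h phi|) (fun=> e^-1)).
    apply: (@continuous_comp _ _ _ h (fun y => `|y|)); last exact: norm_continuous.
    apply: (@continuous_comp _ _ _ (odot T)
      (@normR R k (scalar_field R k)^o : (scalar_field R k)^o -> R)).
      exact: odot_continuous.
    exact: normR_continuous.
  exact: cst_continuous.
have [n [s s4]] := average_bounded4 sigma_haar.2 (compact_prod_group cG)
  (fun phi => orlicz_ge0 hPhi.1 (h0 phi)) (orlicz_comp_continuous hPhi.1 h0 ch) int1.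
pose nu (j : 'I_n.+1) : R := n.+1%:R^-1.
have nu0 j : 0 < nu j by rewrite invr_gt0 ltr0n.
have nu1 : \sum_j nu j = 1.
  by rewrite sumr_const card_ord -[_ *+ _]mulr_natl divff.
pose x (j : 'I_n.+1) : prod_topology
    (fun i => subspace_of (H i) : normedModType (scalar_field R k)) :=
  fun i => translate_in (tH i) (T i) (s j i).
have := uC _ nu x nu0 nu1.
have -> : (fun j => normR (u (x j))) = (fun=> normR (u T)).
  by apply/funext => j; rewrite /x u_invariant.
move=> /(le_trans (lux_seq_cst_ge hPhi nu1 _))/le_trans; apply.
(* After cancelling [C], every choice of functionals has to give a norm of at most [4 * e]. *)
rewrite -!EFinM -mulrA EFinM lee_pmul2l//.
apply: ge_ereal_sup => _ [alpha alpha1 <-].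
apply: (lux_seq_le hPhi e0) => //; [by rewrite ler1n|by move=> j; exact: ltW|].
have e0' : 0 <= e^-1 by rewrite invr_ge0 ltW.
have pos i z : range (fun (p : G i) j =>
      normR (Cfun_fun (val (x j i)) p : (scalar_field R k)^o)) z ->
    forall j, 0 <= z j by move=> [p _ <-] j; exact: normR_ge0.
have [z zS] := dominated_prod_orlicz hPhi.1 (fun j => ltW (nu0 j)) e0'
  (fun i j => normR_ge0 (alpha i (x j i))) pos
  (fun i => dual_ball_dominated (x ^~ i) (alpha1 i)).
have -> : \sum_j nu j * Phi ((\prod_i normR (alpha i (x j i))) / e) =
    \sum_j nu j * Phi (`|normR (\prod_i alpha i (x j i) : (scalar_field R k)^o)| / e).
  by apply: eq_bigr => j _; rewrite ger0_norm ?normR_ge0// normR_prod.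
move=> /le_trans; apply.
(* The exchange yields one point per coordinate [i], the same for all [j]. Together they form a
   single [phi], and the product of the values of the [x j i] there is [odot T] at [s j * phi]. *)
pose phi : prod_group G := fun i => sval (cid2 (zS i)).
have zE i j : z i j = normR (Cfun_fun (val (x j i)) (phi i) : (scalar_field R k)^o).
  by rewrite /phi; case: (cid2 (zS i)) => p _ /= <-.
apply: (@le_trans _ _ (\sum_j n.+1%:R^-1 * Phi (`|h (s j * phi)%g| / e))).
  apply: ler_sum => j _; rewrite /h (ger0_norm (normR_ge0 _)) normR_prod.
  by under eq_bigr do rewrite zE.
by rewrite -mulr_sumr ler_pdivrMl ?ltr0n// [leRHS]mulrC.
Qed.
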